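(* Suppose that $\kappa < \mu$ are infinite cardinals such that $\mathrm{cf}(\mu) < \kappa$ and there does not exist a strongly unbounded subadditive coloring $c:(\mathscr{P}_\kappa \mu^+)^{[2]} \rightarrow \mathrm{cf}(\mu)$. Then $\mathsf{CP}(\mathcal D)$ holds for every uniform, transitive $\mathrm{cf}(\mu)$-covering matrix $\mathcal D$ for $\mu^+$.
   Context: $\mathscr{P}_\kappa X = \{x \subseteq X \mid |x|<\kappa\}$, viewed as a partial order under $\subsetneq$; $(\mathscr{P}_\kappa X)^{[2]}$ is the set of pairs $(x,y)$ of elements of $\mathscr{P}_\kappa X$ with $x \subsetneq y$. For a partial order $\Lambda$ and $\Lambda^{[2]}$ its set of pairs $(u,v)$ with $u<_\Lambda v$, a function $c:\Lambda^{[2]} \to \theta$ is subadditive if for all $u <_\Lambda v <_\Lambda w$: $c(u,w) \leq \max\{c(u,v), c(v,w)\}$ and $c(u,v) \leq \max\{c(u,w), c(v,w)\}$; strongly unbounded if for every cofinal $\Gamma \subseteq \Lambda$, $c``\Gamma^{[2]}$ is unbounded in $\theta$. For regular cardinals $\theta < \lambda$, a $\theta$-covering matrix for $\lambda$ is $\mathcal D = \langle D(i,\beta) \mid i < \theta, \beta < \lambda\rangle$ such that (1) for each $\beta<\lambda$, $\langle D(i,\beta) \mid i < \theta\rangle$ is $\subseteq$-increasing with union $\beta$; (2) for all $\beta < \gamma < \lambda$ and $i < \theta$ there is $j < \theta$ with $D(i,\beta) \subseteq D(j,\gamma)$. $\mathcal D$ is transitive if for all $\beta < \gamma<\lambda$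 and $i<\theta$, $\beta \in D(i,\gamma)$ implies $D(i,\beta) \subseteq D(i,\gamma)$; uniform if for every limit $\beta < \lambda$ there is $i<\theta$ such that $D(i,\beta)$ contains a club in $\beta$. $\mathsf{CP}(\mathcal D)$ holds if there is an unbounded $A \subseteq \lambda$ such that for every $X \in [A]^\theta$ there are $\beta<\lambda$ and $i<\theta$ with $X \subseteq D(i,\beta)$. *)

(* Defs.v *)
From HB Require Import structures.
From mathcomp Require Import all_boot all_order.
From mathcomp Require Import boolp classical_sets functions cardinality.

Set Implicit Arguments.
Unset Strict Implicit.
Unset Printing Implicit Defensive.

Import Order.TTheory.
Local Open Scope classical_set_scope.
Local Open Scope order_scope.
Local Open Scope card_scope.

Reserved Notation "A '#<' B" (at level 79, format "A  '#<'  B").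

Definition card_lt T U (A : set T) (B : set U) : bool :=
  (A #<= B) && ~~ (A #= B).
Notation "A '#<' B" := (card_lt A B) : card_scope.

(* In a limit ordinal, being cofinal is the same as being unbounded. *)
Definition cofinal d (P : porderType d) (A : set P) : Prop :=
  forall x, exists2 y, A y & x <= y.

(* An ordinal is represented by a well-ordered type: its elements are the
   smaller ordinals, and the element b is, as a set, [set a | a < b]. *)
Definition is_ordinal d (T : orderType d) : Prop :=
  well_founded (fun x y : T => x < y).

(* Cardinals are initial ordinals. *)
Definition is_cardinal d (T : orderType d) : Prop :=
  is_ordinal T /\ forall b : T, [set a | a < b] #< [set: T].

Definition is_infinite_cardinal d (T : orderType d) : Prop :=
  is_cardinal T /\ infinite_set [set: T].

(* L = M^+ *)
Definition is_successor_cardinal dL (L : orderType dL) dM (M : orderType dM) :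
    Prop :=
  [/\ is_cardinal L, [set: M] #< [set: L] &
      forall (U : Type) (B : set U), [set: M] #< B -> [set: L] #<= B].

(* T = cf(M), the least cardinality of a cofinal subset of M *)
Definition is_cofinality dT (T : orderType dT) dM (M : orderType dM) : Prop :=
  [/\ is_cardinal T,
      exists2 A : set M, cofinal A & A #= [set: T] &
      forall A : set M, cofinal A -> [set: T] #<= A].

Section Colorings.
Context d (P : porderType d) dT (T : orderType dT).

Definition pairs : Type := {p : P * P | p.1 < p.2}.

Definition mkpair (u v : P) (uv : u < v) : pairs := exist _ (u, v) uv.

Definition subadditive (c : pairs -> T) : Prop :=
  forall (u v w : P) (uv : u < v) (vw : v < w) (uw : u < w),
    c (mkpair uw) <= Order.max (c (mkpair uv)) (c (mkpair vw)) /\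
    c (mkpair uv) <= Order.max (c (mkpair uw)) (c (mkpair vw)).

Definition strongly_unbounded (c : pairs -> T) : Prop :=
  forall G : set P, cofinal G ->
    cofinal (c @` [set p | G (val p).1 /\ G (val p).2]).

End Colorings.

(* The order is inherited from set X, hence < is strict inclusion, see
   lt_PkappaE. *)
Definition Pkappa (K X : Type) : Type :=
  {x : set X | x \in [set y : set X | y #< [set: K]]}.

HB.instance Definition _ (K X : Type) := SubChoice.on (Pkappa K X).
HB.instance Definition _ (K X : Type) :=
  [SubChoice_isSubPOrder of Pkappa K X by <: with set_display].

Lemma lt_PkappaE (K X : Type) (x y : Pkappa K X) :
  (x < y) = (val x `<` val y) :> Prop.
Proof. by rewrite -properEset. Qed.

Section Clubs.
Context d (L : orderType d).

Definition is_limit (b : L) : Prop :=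
  (exists a, a < b) /\ forall a, a < b -> exists2 g, a < g & g < b.

Definition unbounded_below (C : set L) (b : L) : Prop :=
  forall a, a < b -> exists2 g, C g & a <= g /\ g < b.

Definition club_in (C : set L) (b : L) : Prop :=
  [/\ C `<=` [set a | a < b],
      unbounded_below C b &
      forall a, a < b -> is_limit a -> unbounded_below C a -> C a].

End Clubs.

Section CoveringMatrices.
Context dT (T : orderType dT) dL (L : orderType dL).
Implicit Type D : T -> L -> set L.

Definition covering_matrix D : Prop :=
  [/\ forall b i j, i <= j -> D i b `<=` D j b,
      forall b, \bigcup_i D i b = [set a | a < b] &
      forall b g i, b < g -> exists j, D i b `<=` D j g].

Definition transitive_matrix D : Prop :=
  forall b g i, b < g -> D i g b -> D i b `<=` D i g.

Definition uniform_matrix D : Prop :=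
  forall b, is_limit b ->
    exists i, exists2 C : set L, club_in C b & C `<=` D i b.

Definition CP D : Prop :=
  exists2 A : set L, cofinal A &
    forall X : set L, X `<=` A -> X #= [set: T] ->
      exists b i, X `<=` D i b.

End CoveringMatrices.

(* Main.v *)
Require Import Defs.
From HB Require Import structures.
From mathcomp Require Import all_boot all_order.
From mathcomp Require Import boolp classical_sets functions cardinality.
From mathcomp Require wochoice.

(**
  Write F_b(j) = D(j, b) `&` x for x in P_kappa(mu^+). By transitivity F_b is
  included in F_g for b < g at all large j. If for every x this sequence is
  stable from some b_x on, modulo this eventual inclusion, then the least i such
  that D(j, b_x) and D(j, b_y) agree on x for all j >= i is a subadditive
  coloring c(x, y). If c is bounded by i on a cofinal family, choose for every a
  a member x of the family containing a and some j >= i with a \in D(j, b_x): an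
  unbounded fiber of the resulting function mu^+ -> cf(mu) witnesses CP(D).

  Stability is an argument of Shelah, with uniformity as its key input. As mu is
  singular, there are regular cardinals kappa < n < r < mu such that some family
  of r many n-sequences in r guesses every club of r. If the traces on some x
  never became stable, there would be an increasing continuous r-sequence in
  mu^+ along which the traces strictly grow and which anticipates, for every
  initial segment of a sequence of the guessing family, an upper bound of the
  union of the traces on it whenever there is one. By uniformity, the points of
  a club of r have their traces bounded, from one index on, by the trace of the
  supremum of the r-sequence; so the unions along a guessed n-sequence in that
  club are bounded, hence anticipated. As n is larger than |x| and cf(mu), these
  unions stop growing before the end of the n-sequence, and then so do the
  traces: a contradiction.
*)

Set Implicit Arguments.
Unset Strict Implicit.
Unset Printing Implicit Defensive.

Import Order.TTheory.
Local Open Scope order_scope.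
Local Open Scope classical_set_scope.
Local Open Scope card_scope.

(** * Recursion, well-orderings and comparison of cardinals *)

Lemma wf_choice_recursion (I V : Type) (v0 : V) (R : I -> I -> Prop)
    (P : I -> (I -> V) -> V -> Prop) :
  well_founded R ->
  (forall s f g v, (forall t, R t s -> f t = g t) -> P s f v -> P s g v) ->
  (forall s f, exists v, P s f v) ->
  exists f, forall s, P s f (f s).
Proof.
move=> wfR P_local exP.
pose next s f := sval (cid (exP s f)).
pose extend s (g : forall t, R t s -> V) t :=
  if pselect (R t s) is left ts then g t ts else v0.
pose f := Fix wfR (fun=> V) (fun s g => next s (extend s g)).
have fE s : f s = next s (extend s (fun t _ => f t)).
  rewrite /f Fix_eq // => t g h gh; congr (next _ (extend _ _)).
  by apply: functional_extensionality_dep => u; apply/funext/gh.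
exists f => s; rewrite fE.
apply: P_local (svalP (cid (exP s _))) => t ts.
by rewrite /extend; case: pselect.
Qed.

Lemma well_order_total (T : eqType) (le : rel T) :
  wochoice.well_order le -> wochoice.total_order le.
Proof.
move=> wo_le; have le_chain : wochoice.wo_chain le predT.
  exact: wochoice.withinW.
have le_total : total le by move=> x y; exact: (wochoice.wo_chainW le_chain).
have le_anti : antisymmetric le.
  by move=> x y; exact: (wochoice.wo_chain_antisymmetric le_chain).
split=> //; split=> //; split=> [x|y x z xy yz].
  by have := le_total x x; rewrite orbb.
have [|m [[m_in m_le] _]] := wo_le (pred3 x y z).
  by exists x; rewrite inE eqxx.
case/or3P: m_in m_le => /eqP-> m_le.
- by apply: m_le; rewrite !inE eqxx !orbT.
- by have -> : x = y by apply/le_anti; rewrite xy m_le // !inE eqxx.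
- by have -> : z = y by apply/le_anti; rewrite yz m_le // !inE eqxx !orbT.
Qed.

Lemma well_ordering T (A : set T) :
  exists d (W : orderType d), is_ordinal W /\ A #= [set: W].
Proof.
have [le wo_le] := wochoice.well_ordering_principle {classic A}.
have [[[le_refl le_trans] le_anti] le_total] := well_order_total wo_le.
pose disp := Order.Disp tt tt.
pose porder := HB.pack_for (porderType disp) {classic A}
  (Order.Le_isPOrder.Build disp {classic A} le_refl le_anti le_trans).
pose order := HB.pack_for (orderType disp) porder
  (Order.POrder_isTotal.Build disp porder le_total).
exists disp, order; split; last exact: card_setT_sym.
move=> x; apply: contrapT => xNacc.
have [|m [[/asboolP mNacc m_le] _]] :=
  wo_le [pred y | `[< ~ Acc (fun u v : order => u < v) y >]].
  by exists x; apply/asboolP.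
apply: mNacc; constructor=> y; rewrite ltNge => /negP ylt.
by apply: contrapT => yNacc; apply: ylt; apply: m_le; apply/asboolP.
Qed.

Lemma card_le_inj T U (A : set T) (B : set U) (f : T -> U) :
  set_fun A B f -> {in A &, injective f} -> A #<= B.
Proof.
move=> fAB f_inj; suff [g] : $|{injfun A >-> B}| by exact: inj_card_le.
by apply/injfunPex; exists f.
Qed.

(* An injection given by its graph requires no default value in U. *)
Lemma card_le_graphP T U (A : set T) (B : set U) :
  A #<= B <-> exists R : T -> U -> Prop,
    (forall a, A a -> exists2 b, B b & R a b) /\
    (forall a a' b, R a b -> R a' b -> a = a').
Proof.
split=> [/card_leP[f]|[R [R_total R_inj]]].
  exists (fun a b => exists Aa : a \in A, val (f (Sub a Aa)) = b).
  split=> [a /mem_set Aa|a a' _ [Aa <-] [Aa' /val_inj]].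
    by exists (val (f (Sub a Aa))); [exact/set_mem/valP|exists Aa].
  by move=> /(@inj _ _ _ f (Sub a' Aa') (Sub a Aa) (mem_set I) (mem_set I)) [].
have /choice[f fP] : forall a : A, exists b : B, R (val a) (val b).
  move=> a; have [b Bb Rab] := R_total _ (set_mem (valP a)).
  by exists (Sub b (mem_set Bb)).
rewrite -(card_le_eql (card_setT A)) -(card_le_eqr (card_setT B)).
apply: (card_le_inj (f := f)) => // a a' _ _ faa'; apply: val_inj.
by apply: R_inj (fP a) _; rewrite faa'.
Qed.

Lemma card_le_small_segments T (R : T -> T -> Prop) (S : set T) U (B : set U) :
  well_founded R -> (forall s t, s <> t -> R s t \/ R t s) ->
  (forall s, S s -> ~ (B #<= [set t | S t /\ R t s])) ->
  S #<= B.
Proof.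
move=> wfR R_total small.
have [->//|/set0P[s0 Ss0]] := eqVneq S set0.
have [B0|/set0P[b0 _]] := eqVneq B set0.
  by case: (small s0 Ss0); rewrite B0.
have [f fP] : exists f : T -> U, forall s, S s ->
    B (f s) /\ forall t, S t -> R t s -> f t <> f s.
  apply: (wf_choice_recursion b0 (P := fun s f v => S s ->
    B v /\ forall t, S t -> R t s -> f t <> v) wfR) => [s f g v fg fv|s f].
    by move=> /fv[Bv v_new]; split=> // t St ts; rewrite -fg //; exact: v_new.
  have [Ss|] := pselect (S s); last by exists b0.
  apply: contrapT => /forallNP full; apply: (small s Ss).
  apply: card_le_trans (card_image_le f _); apply: subset_card_le => v Bv.
  apply: contrapT => v_new; apply: (full v) => _; split=> // t St ts ft.
  by apply: v_new; exists t.
apply: (card_le_inj (f := f)) => [s /fP[]//|s t /set_mem Ss /set_mem St fst].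
apply: contrapT => /R_total[st|ts].
  by have [_ /(_ s Ss st)] := fP t St.
by have [_ /(_ t St ts)] := fP s Ss; rewrite fst.
Qed.

Lemma card_le_total T U (A : set T) (B : set U) : A #<= B \/ B #<= A.
Proof.
have [d [W [wfW AW]]] := well_ordering A.
rewrite (card_le_eql AW) (card_le_eqr AW).
have [|BW] := pselect (B #<= [set: W]); first by right.
left; apply: (card_le_small_segments wfW) => [s t /eqP/lt_total/orP//|w _ Bw].
by apply: BW; apply: card_le_trans Bw _; exact: card_leT.
Qed.

Lemma card_ltNge T U (A : set T) (B : set U) : (A #< B) = ~~ (B #<= A).
Proof.
rewrite /card_lt card_eq_le; have [AB|BA] := card_le_total A B.
  by rewrite AB.
by rewrite BA andbT andbN.
Qed.

Lemma card_leNgt T U (A : set T) (B : set U) : (A #<= B) = ~~ (B #< A).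
Proof. by rewrite card_ltNge negbK. Qed.

Lemma card_ltW T U (A : set T) (B : set U) : A #< B -> A #<= B.
Proof. by case/andP. Qed.

Lemma card_le_lt_trans T U V (B : set U) (A : set T) (C : set V) :
  A #<= B -> B #< C -> A #< C.
Proof.
by move=> AB; rewrite !card_ltNge; apply: contra => CA; exact: card_le_trans AB.
Qed.

Lemma card_lt_trans T U V (B : set U) (A : set T) (C : set V) :
  A #< B -> B #< C -> A #< C.
Proof. by move=> /card_ltW; exact: card_le_lt_trans. Qed.

Lemma finite_card_lt T U (A : set T) (B : set U) :
  finite_set A -> infinite_set B -> A #< B.
Proof.
move=> Afin Binf; rewrite card_ltNge; apply/negP => BA.
by apply: Binf; exact: card_le_finite Afin.
Qed.

(** * Cardinal arithmetic *)

Lemma card_le_setX T T' U U' (A : set T) (A' : set T')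
    (B : set U) (B' : set U') :
  A #<= B -> A' #<= B' -> A `*` A' #<= B `*` B'.
Proof.
move=> /card_le_graphP[R [R_total R_inj]] /card_le_graphP[R' [R'_total R'_inj]].
apply/card_le_graphP; exists (fun p q => R p.1 q.1 /\ R' p.2 q.2).
split=> [[a a'] [/= /R_total[b Bb Rab] /R'_total[b' Bb' Rab']]|].
  by exists (b, b').
move=> [a a'] [c c'] [b b'] /= [Rab Rab'] [Rcb Rcb'].
by rewrite (R_inj _ _ _ Rab Rcb) (R'_inj _ _ _ Rab' Rcb').
Qed.

Lemma card_le_bigcup I T U (A : set I) (F : I -> set T) (B : set U) :
  (forall i, A i -> F i #<= B) -> \bigcup_(i in A) F i #<= A `*` B.
Proof.
move=> FB; have /choice[R RP] : forall i, exists R : T -> U -> Prop, A i ->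
    (forall t, F i t -> exists2 b, B b & R t b) /\
    (forall t t' b, R t b -> R t' b -> t = t').
  move=> i; have [/FB/card_le_graphP[R RP]|] := pselect (A i).
    by exists R.
  by exists (fun _ _ => True).
apply/card_le_graphP; exists (fun t p => A p.1 /\ R p.1 t p.2); split.
  move=> t [i Ai Fit]; have [/(_ t Fit)[b Bb Rtb] _] := RP i Ai.
  by exists (i, b).
by move=> t t' [i b] /= [/RP[_ R_inj] Rtb] [_]; exact: R_inj.
Qed.

Lemma card_le_setU_setX T U (A B : set T) (C : set U) :
  infinite_set C -> A #<= C -> B #<= C -> A `|` B #<= C `*` C.
Proof.
move=> Cinf AC BC; rewrite -bigcup2inE.
apply: card_le_trans (card_le_bigcup (B := C) _) _ => [[|[|i]] //|].
by apply: card_le_setX (card_lexx C); apply/card_ltW/finite_card_lt.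
Qed.

Lemma set_leE d (W : porderType d) (u : W) :
  [set t | t <= u] = [set t | t < u] `|` [set u].
Proof.
apply/seteqP; split=> t /=; last by move=> [/ltW|->].
by rewrite le_eqVlt => /orP[/eqP|]; [right|left].
Qed.

Section GoedelOrder.
Context d (W : orderType d).

Definition goedel_lt (p q : W * W) : Prop :=
  let m (r : W * W) := Order.max r.1 r.2 in
  m p < m q \/ m p = m q /\ (p.1 < q.1 \/ p.1 = q.1 /\ p.2 < q.2).

Lemma goedel_lt_wf : is_ordinal W -> well_founded goedel_lt.
Proof.
move=> wfW [a b]; move: {2}(Order.max _ _) (erefl (Order.max a b)) => m.
elim/(well_founded_ind wfW): m a b => m IHm a.
elim/(well_founded_ind wfW): a => a IHa b.
elim/(well_founded_ind wfW): b => b IHb mE.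
constructor=> -[a' b'] [/= lt_max|[/= max_eq [lt_fst|[fst_eq lt_snd]]]].
- by apply: (IHm (Order.max a' b')) => //; rewrite -mE.
- by apply: IHa => //; rewrite max_eq.
- by subst a'; apply: IHb => //; rewrite max_eq.
Qed.

Lemma goedel_lt_total p q : p <> q -> goedel_lt p q \/ goedel_lt q p.
Proof.
case: p q => [a b] [a' b'] pq; rewrite /goedel_lt /=.
case: (ltgtP (Order.max a b)) => [_|_|max_eq]; [by left; left|by right; left|].
case: (ltgtP a a') => [_|_|aa']; [by left; right; split=> //; left| |].
  by right; right; split=> //; left.
case: (ltgtP b b') => [_|_|bb'].
- by left; right; split=> //; right.
- by right; right; split=> //; right.
- by case: pq; rewrite aa' bb'.
Qed.

(* When no segment is equinumerous with S, a proper initial segment of S `*` S in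
   Goedel's ordering is included in the square of a segment smaller than S. *)
Lemma card_le_setX_lower_set (S : set W) :
  is_ordinal W -> (forall a b, S b -> a < b -> S a) ->
  (forall a, S a -> infinite_set [set b | b < a] ->
     [set b | b < a] `*` [set b | b < a] #<= [set b | b < a]) ->
  infinite_set S -> S `*` S #<= S.
Proof.
move=> wfW lowS segX Sinf.
have [[a [Sa Sle]]|noseg] := pselect (exists a, S a /\ S #<= [set b | b < a]).
  apply: card_le_trans (card_le_setX Sle Sle) _.
  apply: card_le_trans (segX a Sa _) _.
    by move=> fin; apply: Sinf; exact: card_le_finite Sle fin.
  by apply: subset_card_le => b; exact: lowS.
apply: (card_le_small_segments (goedel_lt_wf wfW)) => [|[p q] [/= Sp Sq]].
  exact: goedel_lt_total.
pose m := Order.max p q; pose M := [set b | b <= m].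
have Sm : S m by rewrite /m; case: (leP p q).
apply/negP; rewrite -card_ltNge.
apply: (@card_le_lt_trans _ _ _ (M `*` M)).
  apply: subset_card_le => -[a b] [_ lt_pq] /=.
  have : Order.max a b <= m by case: lt_pq => /= [/ltW|[-> _]].
  by rewrite ge_max => /andP[].
have ME : M = [set b | b < m] `|` [set m] by exact: set_leE.
have [fin|inf] := pselect (finite_set [set b | b < m]).
  have Mfin : finite_set M.
    by rewrite ME finite_setU; split=> //; exact: finite_set1.
  by apply: finite_card_lt => //; exact: finite_setX.
have Mle : M #<= [set b | b < m].
  rewrite ME; apply: card_le_trans (segX m Sm inf).
  apply: (card_le_setU_setX inf (card_lexx _)).
  by apply/card_ltW/finite_card_lt => //; exact: finite_set1.
apply: card_le_lt_trans (card_le_setX Mle Mle) _.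
apply: card_le_lt_trans (segX m Sm inf) _.
by rewrite card_ltNge; apply/negP => Sle; apply: noseg; exists m.
Qed.

End GoedelOrder.

Lemma card_le_setX_infinite T (A : set T) : infinite_set A -> A `*` A #<= A.
Proof.
have [d [W [wfW AW]]] := well_ordering A.
move=> Ainf; have Winf : infinite_set [set: W].
  by move=> fin; apply: Ainf; rewrite (eq_finite_set AW).
have WX : [set: W] `*` [set: W] #<= [set: W].
  apply: card_le_setX_lower_set => // a _.
  elim/(well_founded_ind wfW): a => a IHa.
  by apply: card_le_setX_lower_set => // b c /= ca bc; exact: lt_trans ca.
rewrite (card_le_eqr AW); apply: card_le_trans WX.
by apply: card_le_setX; rewrite (card_le_eql AW) card_lexx.
Qed.

Lemma card_le_setU T U (A B : set T) (C : set U) :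
  infinite_set C -> A #<= C -> B #<= C -> A `|` B #<= C.
Proof.
move=> Cinf AC BC; apply: card_le_trans (card_le_setX_infinite Cinf).
exact: card_le_setU_setX.
Qed.

Lemma card_lt_setU T U (A B : set T) (C : set U) :
  infinite_set C -> A #< C -> B #< C -> A `|` B #< C.
Proof.
move=> Cinf; wlog AB : A B / A #<= B => [th AC BC|AC BC].
  by have [/th->//|/th] := card_le_total A B; rewrite setUC; apply.
have [Bfin|Binf] := pselect (finite_set B).
  apply: finite_card_lt => //; rewrite finite_setU; split=> //.
  exact: card_le_finite Bfin.
by apply: card_le_lt_trans BC; apply: card_le_setU (card_lexx B).
Qed.

(** * Ordinals and regular cardinals *)

Lemma ordinal_least d (W : orderType d) (wfW : is_ordinal W) (A : set W) :
  A !=set0 -> exists2 m, A m & forall a, A a -> m <= a.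
Proof.
move=> [a Aa]; elim/(well_founded_ind wfW): a Aa => a IHa Aa.
have [[b [ba Ab]]|a_least] := pselect (exists b, b < a /\ A b).
  exact: IHa ba Ab.
exists a => // b Ab; rewrite leNgt; apply/negP => ba.
by apply: a_least; exists b.
Qed.

Definition is_strict_sup d (W : orderType d) (A : set W) (s : W) : Prop :=
  (forall a, A a -> a < s) /\ (forall v, v < s -> exists2 a, A a & v <= a).

Lemma strict_sup_exists d (W : orderType d) (wfW : is_ordinal W) (A : set W) :
  (exists w, forall a, A a -> a < w) -> exists s, is_strict_sup A s.
Proof.
move=> /(ordinal_least wfW)[s sA s_le]; exists s; split=> // v.
rewrite ltNge => /negP vs; apply: contrapT => v_ub; apply: vs.
apply: s_le => a Aa.
by rewrite ltNge; apply/negP => va; apply: v_ub; exists a.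
Qed.

Lemma not_cofinalP d (W : orderType d) (A : set W) :
  ~ cofinal A <-> exists w, forall a, A a -> a < w.
Proof.
split=> [/existsNP[w w_ub]|[w w_ub] /(_ w)[a /w_ub]].
  by exists w => a Aa; rewrite ltNge; apply/negP => wa; apply: w_ub; exists a.
by rewrite ltNge => /negP.
Qed.

Section InfiniteCardinals.
Context d (W : orderType d) (W_card : is_infinite_cardinal W).

Lemma card_lt_closed_segment (u : W) : [set t | t <= u] #< [set: W].
Proof.
have [[_ initW] Winf] := W_card.
rewrite set_leE; apply: card_lt_setU => //.
by apply: finite_card_lt => //; exact: finite_set1.
Qed.

Lemma infinite_cardinal_gt (u : W) : exists v, u < v.
Proof.
have := card_lt_closed_segment u; rewrite card_ltNge => /negP segW.
apply: contrapT => u_max; apply: segW; apply: subset_card_le => v _ /=.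
by rewrite leNgt; apply/negP => uv; apply: u_max; exists v.
Qed.

End InfiniteCardinals.

Definition is_regular d (W : orderType d) : Prop :=
  is_infinite_cardinal W /\ is_cofinality W W.

Section RegularCardinals.
Context d (W : orderType d) (W_reg : is_regular W).

Lemma regular_ordinal : is_ordinal W.
Proof. by have [[[]]] := W_reg. Qed.

Lemma regular_infinite_cardinal : is_infinite_cardinal W.
Proof. by have [] := W_reg. Qed.

Lemma regular_infinite : infinite_set [set: W].
Proof. by have [] := regular_infinite_cardinal. Qed.

Lemma regular_setT_neq0 : [set: W] !=set0.
Proof. exact: infinite_setN0 regular_infinite. Qed.

Lemma regular_bounded X (A : set X) (f : X -> W) :
  A #< [set: W] -> exists w, forall x, A x -> f x < w.
Proof.
have [_ [_ _ cofW]] := W_reg => AW.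
have /not_cofinalP[w fw] : ~ cofinal (f @` A).
  move=> /cofW; apply/negP; rewrite -card_ltNge.
  exact: card_le_lt_trans (card_image_le f A) AW.
by exists w => x Ax; apply: fw; exists x.
Qed.

Lemma regular_bounded2 X Y (A : set X) (B : set Y) (f : X -> Y -> W) :
  A #< [set: W] -> B #< [set: W] ->
  exists w, forall x y, A x -> B y -> f x y < w.
Proof.
move=> AW BW.
have /choice[g gP] : forall x, exists w, forall y, B y -> f x y < w.
  by move=> x; exact: regular_bounded.
have [w gw] := regular_bounded g AW.
by exists w => x y Ax By; exact: lt_trans (gP x y By) (gw x Ax).
Qed.

Lemma regular_strict_sup X (A : set X) (f : X -> W) :
  A #< [set: W] -> exists s, is_strict_sup (f @` A) s.
Proof.
move=> /(regular_bounded f)[w fw]; apply: strict_sup_exists regular_ordinal _ _.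
by exists w => _ [x Ax <-]; exact: fw.
Qed.

Lemma cofinal_increasing_sequence dN (N : orderType dN) (E : set W) :
  is_ordinal N -> [set: N] #< [set: W] -> cofinal E ->
  exists e : N -> W, (forall n, E (e n)) /\ {homo e : m n / m < n}.
Proof.
move=> wfN NW cofE; have [w0 _] := regular_setT_neq0.
have [e eP] : exists e : N -> W, forall n,
    E (e n) /\ forall m, m < n -> e m < e n.
  apply: (wf_choice_recursion w0 (P := fun n e v =>
    E v /\ forall m, m < n -> e m < v) wfN) => [n e e' v ee' [Ev ev]|n e].
    by split=> // m mn; rewrite -ee' //; exact: ev.
  have [w ew] := regular_bounded e NW; have [v Ev wv] := cofE w.
  by exists v; split=> // m _; exact: lt_le_trans (ew m I) wv.
by exists e; split=> [n|m n]; [have [] := eP n|have [_ +] := eP n; exact].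
Qed.

End RegularCardinals.

Section SuccessorCardinals.
Context dL (L : orderType dL) dM (M : orderType dM).

Lemma card_lt_successor X (A : set X) :
  is_successor_cardinal L M -> (A #< [set: L]) = (A #<= [set: M]).
Proof.
move=> [_ ML minL]; apply/idP/idP => [|AM]; last exact: card_le_lt_trans ML.
by rewrite card_ltNge (card_leNgt A); apply: contra => /minL.
Qed.

Lemma small_segments_successor :
  is_ordinal L -> [set: M] #< [set: L] ->
  (forall b : L, [set a | a < b] #<= [set: M]) -> is_successor_cardinal L M.
Proof.
move=> wfL ML segM; split=> // [|U B MB].
  by split=> // b; exact: card_le_lt_trans ML.
apply: (card_le_small_segments wfL) => [s t /eqP/lt_total/orP//|s _ Bs].
move: MB; rewrite card_ltNge => /negP; apply.
apply: card_le_trans (segM s); apply: card_le_trans Bs _.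
by apply: subset_card_le => t [].
Qed.

Lemma successor_regular :
  infinite_set [set: M] -> is_successor_cardinal L M -> is_regular L.
Proof.
move=> Minf succL; have [Lcard ML _] := succL.
have L_card : is_infinite_cardinal L.
  by split=> // Lfin; apply: Minf; exact: card_le_finite (card_ltW ML) Lfin.
split=> //; split=> // [|A cofA]; first by exists [set: L] => // x; exists x.
rewrite card_leNgt card_lt_successor //; apply/negP => AM.
have LE : [set: L] = \bigcup_(a in A) [set w | w <= a].
  by apply/seteqP; split=> // w _; have [a Aa wa] := cofA w; exists a.
move: ML; rewrite card_ltNge => /negP; apply.
apply: card_le_trans (card_le_setX_infinite Minf).
apply: card_le_trans (card_le_setX AM (card_lexx [set: M])).
rewrite LE; apply: card_le_bigcup => a _.
by rewrite -card_lt_successor //; exact: card_lt_closed_segment.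
Qed.

End SuccessorCardinals.

Definition segment d (W : orderType d) (b : W) : Type := [set a | a < b].

HB.instance Definition _ d (W : orderType d) (b : W) :=
  SubChoice.on (segment b).
HB.instance Definition _ d (W : orderType d) (b : W) :=
  [SubChoice_isSubOrder of segment b by <: with d].

Section Segments.
Context d (W : orderType d).

Lemma card_le_segment (b : W) U (B : set U) :
  ([set: segment b] #<= B) = ([set a | a < b] #<= B).
Proof. exact/card_le_eql/card_setT. Qed.

Lemma card_lt_segment (b : W) : is_cardinal W -> [set: segment b] #< [set: W].
Proof.
by move=> [_ /(_ b)]; apply: card_le_lt_trans; rewrite card_le_segment.
Qed.

Lemma segment_ordinal (b : W) : is_ordinal W -> is_ordinal (segment b).
Proof.
move=> wfW s; have [a aE] : exists a, val s = a by exists (val s).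
elim/(well_founded_ind wfW): a s aE => a IHa s sE.
by constructor=> t ts; apply: (IHa (val t)); rewrite // -sE.
Qed.

Lemma cofinality_lt_singular dT (T : orderType dT) :
  is_cofinality T W -> [set: T] #< [set: W] -> ~ is_regular W.
Proof.
move=> [_ [A cofA AT] _] TW [_ [_ _ /(_ A cofA)]].
by rewrite (card_le_eqr AT); apply/negP; rewrite -card_ltNge.
Qed.

(* A singular W is not the successor of B, so one of its segments is. *)
Lemma regular_below_singular dB (B : orderType dB) :
  is_ordinal W -> ~ is_regular W -> infinite_set [set: B] ->
  [set: B] #< [set: W] ->
  exists2 b : W, is_regular (segment b) & [set: B] #< [set: segment b].
Proof.
move=> wfW Wsing Binf BW.
have [b] : exists2 b : W, [set: B] #< [set c | c < b] &
    forall a, [set: B] #< [set c | c < a] -> b <= a.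
  apply: ordinal_least => //; apply: contrapT => noseg.
  apply: Wsing; apply: successor_regular Binf _.
  apply: small_segments_successor => // b.
  by rewrite card_leNgt; apply/negP => Bb; apply: noseg; exists b.
move=> Bb b_least.
have {}Bb : [set: B] #< [set: segment b].
  by move: Bb; rewrite !card_ltNge card_le_segment.
exists b; [apply: successor_regular Binf _|exact: Bb].
apply: small_segments_successor => [|//|s]; first exact: segment_ordinal.
have sb : val s < b := set_mem (valP s).
apply: (@card_le_trans _ _ _ [set c | c < val s]).
  by apply: (card_le_inj (f := val)) => // t u _ _ /val_inj.
by rewrite card_leNgt; apply/negP => /b_least; rewrite leNgt sb.
Qed.

End Segments.

(** * Club guessing *)

Section ClosurePoints.
Context d (W : orderType d).

Definition closure_points (G : set (W -> W)) : set W :=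
  [set s | forall g, G g -> forall t, t < s -> g t < s].

Lemma closure_points_sub (G H : set (W -> W)) :
  G `<=` H -> closure_points H `<=` closure_points G.
Proof. by move=> GH s Hs g /GH; exact: Hs. Qed.

Lemma closure_points_cofinal (G : set (W -> W)) :
  is_regular W -> [set: nat] #< [set: W] -> G #< [set: W] ->
  cofinal (closure_points G).
Proof.
move=> W_reg natW GW w.
have /choice[h hP] : forall u, exists v, forall g t, G g -> t <= u -> g t < v.
  move=> u; apply: (regular_bounded2 W_reg (fun g t => g t) GW).
  exact/card_lt_closed_segment/regular_infinite_cardinal.
pose u n := iter n h w.
have [s [us s_le]] := regular_strict_sup W_reg u natW.
exists s => [g Gg t /s_le[_ [n _ <-] tu]|]; last by apply/ltW/us; exists 0%N.
by apply: lt_trans (hP _ _ _ Gg tu) _; apply: us; exists n.+1.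
Qed.

Definition is_last_below (E : set W) (w p : W) : Prop :=
  [/\ E p, p <= w & forall e, E e -> e <= w -> e <= p].

Definition last_below (E : set W) (w : W) : W := xget w (is_last_below E w).

(* The least element of W is vacuously a closure point. *)
Lemma last_closure_point (G : set (W -> W)) (w : W) : is_ordinal W ->
  is_last_below (closure_points G) w (last_below (closure_points G) w).
Proof.
move=> wfW; apply: xgetPex.
have [p p_ub p_le] := ordinal_least wfW (A := [set p | forall e,
  closure_points G e -> e <= w -> e <= p]) (ex_intro _ w (fun e _ => id)).
exists p; split=> //; last by apply: p_le => e.
move=> g Gg t tp; have [e [Ee ew te]] :
    exists e, [/\ closure_points G e, e <= w & t < e].
  move: tp; rewrite ltNge => /negP tp; apply: contrapT => noe.
  apply: tp; apply: p_le => e Ee ew.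
  by rewrite leNgt; apply/negP => te; apply: noe; exists e.
exact: lt_le_trans (Ee g Gg t te) (p_ub e Ee ew).
Qed.

Lemma last_closure_point_le (G H : set (W -> W)) (v w : W) : is_ordinal W ->
  G `<=` H -> v <= w ->
  last_below (closure_points H) v <= last_below (closure_points G) w.
Proof.
move=> wfW GH vw; have [Hp pv _] := last_closure_point H v wfW.
have [_ _] := last_closure_point G w wfW.
by apply; [exact: closure_points_sub Hp|exact: le_trans pv vw].
Qed.

End ClosurePoints.

Lemma nonincreasing_family_stationary dW (W : orderType dW)
    dI (I : orderType dI) X (f : X -> I -> W) :
  is_ordinal W -> is_regular I -> [set: X] #< [set: I] ->
  (forall x i j, i <= j -> f x j <= f x i) ->
  exists i, forall x j, i <= j -> f x j = f x i.
Proof.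
move=> wfW I_reg XI f_mono; have [i0 _] := regular_setT_neq0 I_reg.
have /choice[st stP] : forall x, exists i, forall j, f x i <= f x j.
  move=> x; have [_ [i _ <-] i_le] :=
    ordinal_least wfW (ex_intro (range (f x)) _ (imageT (f x) i0)).
  by exists i => j; apply: i_le; exists j.
have [i sti] := regular_bounded I_reg st XI.
have fE x j : i <= j -> f x j = f x (st x).
  move=> ij; apply/eqP; rewrite eq_le stP andbT.
  by apply: f_mono; exact: le_trans (ltW (sti x _)) ij.
by exists i => x j ij; rewrite !fE.
Qed.

Section ClubGuessing.
Context dW (W : orderType dW) dN (N : orderType dN).

(* If g maps every point to a larger element of a club, then all closure points
   of g but the least element of W belong to the club: guessing closure points
   is guessing clubs. *)
Definition guesses (c : N -> W) (g : W -> W) : Prop :=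
  [/\ {homo c : m n / m <= n}, forall n, closure_points [set g] (c n) &
      forall m, exists n, c m < c n].

Definition cofinal_in (a : N -> W) (w : W) : Prop :=
  [/\ {homo a : m n / m <= n}, forall n, a n < w &
      forall v, v < w -> exists n, v <= a n].

Lemma strict_sup_cofinal_in (e : N -> W) (w : W) :
  {homo e : m n / m < n} -> is_strict_sup (range e) w -> cofinal_in e w.
Proof.
move=> e_mono [ew w_le]; split=> [m n|n|v /w_le[_ [n _ <-]]]; last by exists n.
  by rewrite le_eqVlt => /orP[/eqP->//|/e_mono/ltW].
by apply: ew; exists n.
Qed.

Lemma last_closure_point_growing (G : set (W -> W)) (e a : N -> W) (w : W) :
  is_ordinal W -> (forall m : N, exists n, m < n) ->
  {homo e : m n / m < n} -> (forall n, closure_points G (e n)) ->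
  is_strict_sup (range e) w -> cofinal_in a w ->
  forall m, exists n,
    last_below (closure_points G) (a m) < last_below (closure_points G) (a n).
Proof.
move=> wfW N_gt e_mono eG [ew w_le] [_ aw a_cof] m.
have [_ [k _ <-] am_ek] := w_le _ (aw m).
have [l kl] := N_gt k; have [n el_an] : exists n, e l <= a n.
  by apply: a_cof; apply: ew; exists l.
exists n; have [_ last_le _] := last_closure_point G (a m) wfW.
have [_ _ last_ge] := last_closure_point G (a n) wfW.
apply: le_lt_trans (le_trans last_le am_ek) _.
exact: lt_le_trans (e_mono _ _ kl) (last_ge _ (eG l) el_an).
Qed.

Lemma refutation_sequence dI (I : orderType dI)
    (candidate : set (W -> W) -> W -> N -> W) :
  is_ordinal I ->
  (forall c : W -> N -> W, exists g, forall w, ~ guesses (c w) g) ->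
  exists g : I -> W -> W, forall i w,
    ~ guesses (candidate (g @` [set k | k < i]) w) (g i).
Proof.
move=> wfI refute; apply: (wf_choice_recursion id (P := fun i g h =>
  forall w, ~ guesses (candidate (g @` [set k | k < i]) w) h) wfI) => //.
move=> i g g' h gg'.
by have <- : g @` [set k | k < i] = g' @` [set k | k < i] by exact: eq_imagel.
Qed.

(* Shelah: a candidate approximates a cofinal sequence of some w from below by
   closure points of the functions that refuted the previous candidates. If
   every candidate were refuted, these approximations, being nonincreasing,
   would be stationary from some stage i on for a w that is a limit of common
   closure points; candidate i would then guess its own refutation. *)
Theorem club_guessing dI (I : orderType dI) :
  is_regular W -> is_regular I -> is_regular N ->
  [set: N] #< [set: I] -> [set: I] #< [set: W] ->
  exists c : W -> N -> W, forall g, exists w, guesses (c w) g.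
Proof.
move=> W_reg I_reg N_reg NI IW.
have NW := card_lt_trans NI IW; have wfW := regular_ordinal W_reg.
have I_card := regular_infinite_cardinal I_reg.
have [w0 _] := regular_setT_neq0 W_reg.
pose a w := xget (fun=> w0) [set a' : N -> W | cofinal_in a' w].
pose candidate G w n := last_below (closure_points G) (a w n).
apply: contrapT => noguess.
have refute (c : W -> N -> W) : exists g, forall w, ~ guesses (c w) g.
  apply: contrapT => /forallNP c_guess; apply: noguess; exists c => g.
  by have /existsNP[w /contrapT] := c_guess g; exists w.
have [g gP] := refutation_sequence candidate (regular_ordinal I_reg) refute.
have natW : [set: nat] #< [set: W].
  by apply: card_le_lt_trans NW; apply/infiniteP; exact: regular_infinite.
have cofg : cofinal (closure_points (range g)).
  apply: closure_points_cofinal => //.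
  by apply: card_le_lt_trans IW; exact: card_image_le.
have [e [eg e_mono]] :=
  cofinal_increasing_sequence W_reg (regular_ordinal N_reg) NW cofg.
have [w w_sup] := regular_strict_sup W_reg e NW.
have aw : cofinal_in (a w) w.
  apply: (@xgetI _ _ [set a' | cofinal_in a' w] e).
  exact: strict_sup_cofinal_in w_sup.
have gS i j : i <= j -> g @` [set k | k < i] `<=` g @` [set k | k < j].
  by move=> ij; apply: image_subset => k /= ki; exact: lt_le_trans ki ij.
have [i iP] := nonincreasing_family_stationary wfW I_reg NI
  (fun n i j ij => last_closure_point_le wfW (gS i j ij) (lexx (a w n))).
have [j ij] := infinite_cardinal_gt I_card i.
apply: (gP i w); split=> [m n mn|n|].
- by apply: last_closure_point_le => //; have [+ _ _] := aw; exact.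
- rewrite /candidate -(iP n j (ltW ij)) => _ ->.
  have [+ _ _] := last_closure_point (g @` [set k | k < j]) (a w n) wfW.
  by apply; exists i.
- apply: (last_closure_point_growing wfW _ e_mono _ w_sup aw).
    exact/infinite_cardinal_gt/regular_infinite_cardinal.
  by move=> n; apply: closure_points_sub (eg n); exact: image_subset.
Qed.

End ClubGuessing.

Corollary club_guessing_below_singular dM (M : orderType dM)
    dB (B : orderType dB) :
  is_cardinal M -> ~ is_regular M -> infinite_set [set: B] ->
  [set: B] #< [set: M] ->
  exists n r : M, [/\ is_regular (segment n), is_regular (segment r),
    [set: B] #< [set: segment n], [set: segment n] #< [set: segment r] &
    exists c : segment r -> segment n -> segment r,
      forall g, exists w, guesses (c w) g].
Proof.
move=> M_card M_sing Binf BM; have [wfM _] := M_card.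
have segM b := card_lt_segment b M_card.
have [n n_reg Bn] := regular_below_singular wfM M_sing Binf BM.
have [i i_reg ni] :=
  regular_below_singular wfM M_sing (regular_infinite n_reg) (segM n).
have [r r_reg ir] :=
  regular_below_singular wfM M_sing (regular_infinite i_reg) (segM i).
exists n, r; split=> [//|//|//||]; first exact: card_lt_trans ni ir.
exact: club_guessing r_reg i_reg n_reg ni ir.
Qed.

(** * Stabilization of traces *)

Section EventualInclusion.
Context dT (T : orderType dT) (Y : Type).
Implicit Types F G H : T -> set Y.

Definition eventually_sub F G : Prop :=
  exists i, forall j, i <= j -> F j `<=` G j.

Lemma eventually_sub_trans G F H :
  eventually_sub F G -> eventually_sub G H -> eventually_sub F H.
Proof.
move=> [i FG] [k GH]; exists (Order.max i k) => j.
by rewrite ge_max => /andP[/FG + /GH]; exact: subset_trans.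
Qed.

Lemma eventually_sub_anti F G :
  eventually_sub F G -> eventually_sub G F ->
  exists i, forall j, i <= j -> F j = G j.
Proof.
move=> [i FG] [k GF]; exists (Order.max i k) => j.
by rewrite ge_max => /andP[/FG ? /GF ?]; exact/seteqP.
Qed.

Lemma bigcup_stationary dN (N : orderType dN) (A : N -> T -> set Y)
    (x : set Y) :
  is_regular N -> [set: T] #< [set: N] -> x #< [set: N] ->
  (forall n j, A n j `<=` x) ->
  exists n, forall m j, A m j `<=` \bigcup_(k in [set k | k <= n]) A k j.
Proof.
move=> N_reg TN xN Ax; have [n0 _] := regular_setT_neq0 N_reg.
pose witness y j := xget n0 [set k | A k j y].
have [n nP] := regular_bounded2 N_reg witness xN TN.
exists n => m j y Ay; exists (witness y j).
  by apply/ltW/nP => //; exact: Ax Ay.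
exact: (@xgetI _ n0 [set k | A k j y] m).
Qed.

End EventualInclusion.

Section AnticipatingSequences.
Context dT (T : orderType dT) (Y : Type).
Context dL (L : orderType dL) (F : L -> T -> set Y).
Context dR (R : orderType dR) dN (N : orderType dN).

Definition stable_at (b : L) : Prop :=
  forall g, b <= g -> eventually_sub (F g) (F b).

Definition normal_sequence (e z : R -> L) : Prop :=
  forall s, is_strict_sup (z @` [set t | t < s]) (e s) /\ e s <= z s.

Definition initial_union (e : R -> L) (a : N -> R) (n : N) (j : T) : set Y :=
  \bigcup_(k in [set k | k <= n]) F (e (a k)) j.

Definition anticipates (c : R -> N -> R) (e z : R -> L) : Prop :=
  forall s w n, (forall k, k <= n -> c w k < s) ->
    (exists b, eventually_sub (initial_union e (c w) n) (F b)) ->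
    eventually_sub (initial_union e (c w) n) (F (z s)).

Lemma initial_union_bounded (c : R -> N -> R) (e : R -> L) :
  is_regular L -> [set: R] #< [set: L] -> [set: N] #< [set: L] ->
  exists b, forall w n,
    (exists g, eventually_sub (initial_union e (c w) n) (F g)) ->
    exists2 g, g <= b & eventually_sub (initial_union e (c w) n) (F g).
Proof.
move=> L_reg RL NL; have [l0 _] := regular_setT_neq0 L_reg.
pose bound w n :=
  xget l0 [set g | eventually_sub (initial_union e (c w) n) (F g)].
have [b bP] := regular_bounded2 L_reg bound RL NL.
by exists b => w n /(xgetPex l0); exists (bound w n); first exact/ltW/bP.
Qed.

Lemma anticipating_sequence (c : R -> N -> R) :
  is_regular L -> is_ordinal R ->
  [set: R] #< [set: L] -> [set: N] #< [set: L] ->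
  (forall b g, b <= g -> eventually_sub (F b) (F g)) ->
  (forall b, ~ stable_at b) ->
  exists e z, [/\ normal_sequence e z,
    forall s, ~ eventually_sub (F (z s)) (F (e s)) & anticipates c e z].
Proof.
move=> L_reg wfR RL NL F_mono unstable.
have [l0 _] := regular_setT_neq0 L_reg.
pose step s (f : R -> L * L) (v : L * L) := [/\
  is_strict_sup ((snd \o f) @` [set t | t < s]) v.1 /\ v.1 <= v.2,
  ~ eventually_sub (F v.2) (F v.1) &
  forall w n, (forall k, k <= n -> c w k < s) ->
    (exists b, eventually_sub (initial_union (fst \o f) (c w) n) (F b)) ->
    eventually_sub (initial_union (fst \o f) (c w) n) (F v.2)].
have [f fP] : exists f, forall s, step s f (f s); last first.
  exists (fst \o f), (snd \o f); split=> s; first by have [] := fP s.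
    by have [_ +] := fP s.
  by have [_ _] := fP s.
apply: (wf_choice_recursion (l0, l0) wfR) => [s f g v fg [sup_v ? anti_v]|s f].
  have img : (snd \o f) @` [set t | t < s] = (snd \o g) @` [set t | t < s].
    by apply: eq_imagel => t /= /fg->.
  split=> [|//|w n cs]; first by rewrite -img.
  suff -> : initial_union (fst \o g) (c w) n = initial_union (fst \o f) (c w) n.
    exact: anti_v.
  by apply/funext => j; apply: eq_bigcupr => k kn /=; rewrite fg //; exact: cs.
have [u u_sup] : exists u, is_strict_sup ((snd \o f) @` [set t | t < s]) u.
  apply: (regular_strict_sup L_reg).
  by apply: card_le_lt_trans RL; exact: card_leT.
have [b bP] := initial_union_bounded c (fst \o f) L_reg RL NL.
have /existsNP[v /not_implyP[+ v_grow]] := unstable (Order.max u b).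
rewrite ge_max => /andP[uv bv]; exists (u, v); split=> // [vu|w n _ bounded].
  apply: v_grow; apply: eventually_sub_trans vu (F_mono _ _ _).
  by rewrite le_max lexx.
have [g gb gP] := bP w n bounded.
by apply: eventually_sub_trans gP (F_mono _ _ _); exact: le_trans bv.
Qed.

End AnticipatingSequences.

Section NormalSequences.
Context dL (L : orderType dL) dR (R : orderType dR) (e z : R -> L).
Hypothesis ez_normal : normal_sequence e z.

Lemma normal_sequence_lt s t : s < t -> z s < e t.
Proof. by have [[z_lt _] _] := ez_normal t => st; apply: z_lt; exists s. Qed.

Lemma normal_sequence_homo : {homo e : s t / s < t}.
Proof.
by move=> s t /normal_sequence_lt; have [_] := ez_normal s; exact: le_lt_trans.
Qed.

Lemma normal_sequence_approx s v : v < e s -> exists2 t, t < s & v <= z t.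
Proof. by have [[_ e_le] _] := ez_normal s => /e_le[_ [t ts <-]]; exists t. Qed.

Lemma normal_sequence_club (C : set L) (b : L) :
  (forall s : R, exists t, s < t) -> is_strict_sup (range z) b -> club_in C b ->
  exists h : R -> R, forall s,
    closure_points [set h] s -> (exists t, t < s) -> C (e s).
Proof.
move=> R_gt [zb b_le] [_ C_unb C_closed].
have eb s : e s < b.
  by have [_ /le_lt_trans] := ez_normal s; apply; apply: zb; exists s.
have /choice[h hP] : forall t, exists s, exists2 q, C q & e t <= q /\ q < e s.
  move=> t; have [q Cq [tq /b_le[_ [s _ <-] qs]]] := C_unb _ (eb t).
  have [s' ss'] := R_gt s; exists s', q => //; split=> //.
  exact: le_lt_trans qs (normal_sequence_lt ss').
have h_gt t : t < h t.
  have [q _ [tq qh]] := hP t; rewrite ltNge; apply/negP => h_le.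
  have := le_lt_trans tq qh; rewrite ltNge => /negP; apply.
  by move: h_le; rewrite le_eqVlt => /orP[/eqP->//|/normal_sequence_homo/ltW].
exists h => s /(_ h erefl) hs [t0 t0s].
apply: C_closed => [//||a /normal_sequence_approx[t ts at_]].
  split=> [|a /normal_sequence_approx[t ts at_]].
    by exists (e t0); exact: normal_sequence_homo.
  exists (e (h t)); last exact/normal_sequence_homo/hs.
  exact: le_lt_trans at_ (normal_sequence_lt (h_gt t)).
have [q Cq [tq qh]] := hP (h t); exists q => //; split.
  exact: le_trans at_ (le_trans (ltW (normal_sequence_lt (h_gt t))) tq).
by apply: lt_trans qh _; exact/normal_sequence_homo/hs/hs.
Qed.

End NormalSequences.

Section Traces.
Context dT (T : orderType dT) dL (L : orderType dL) (D : T -> L -> set L).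
Hypotheses (L_reg : is_regular L).
Hypotheses (covD : covering_matrix D) (trD : transitive_matrix D).

Definition trace (x : set L) (b : L) (j : T) : set L := D j b `&` x.

Lemma covering_matrix_lt j b a : D j b a -> a < b.
Proof.
have [_ D_cup _] := covD => Da.
have : (\bigcup_i D i b) a by exists j.
by rewrite D_cup.
Qed.

Lemma trace_eventually_sub x b g :
  b <= g -> eventually_sub (trace x b) (trace x g).
Proof.
have [D_mono D_cup _] := covD.
have D_index a g' : a < g' -> exists i, D i g' a.
  move=> ag'; have : (\bigcup_i D i g') a by rewrite D_cup.
  by case=> i _ Da; exists i.
rewrite le_eqVlt => /orP[/eqP->|/[dup] bg /D_index[i Db]].
  have L_card := regular_infinite_cardinal L_reg.
  have [g' /D_index[i _]] := infinite_cardinal_gt L_card g.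
  by exists i => j _ a.
by exists i => j ij; apply: setSI; apply: trD => //; exact: D_mono ij _ Db.
Qed.

Lemma uniform_matrix_normal_sequence dR (R : orderType dR) (e z : R -> L) :
  uniform_matrix D -> is_infinite_cardinal R ->
  [set: R] #< [set: L] -> normal_sequence e z ->
  exists b i (h : R -> R), forall s j, closure_points [set h] s -> i <= j ->
    D j (e s) `<=` D j b.
Proof.
move=> unifD R_card RL ez_normal; have R_gt := infinite_cardinal_gt R_card.
have [b b_sup] := regular_strict_sup L_reg z RL; have [zb b_le] := b_sup.
have b_limit : is_limit b.
  have [r _] := infinite_setN0 (proj2 R_card).
  split=> [|a /b_le[_ [s _ <-] as_]].
    by exists (z r); apply: zb; exists r.
  have [t st] := R_gt s; exists (e t).
    exact: le_lt_trans as_ (normal_sequence_lt ez_normal st).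
  by have [_ /le_lt_trans] := ez_normal t; apply; apply: zb; exists t.
have [i [C C_club CD]] := unifD b b_limit.
have [h hP] := normal_sequence_club ez_normal R_gt b_sup C_club.
exists b, i, h => s j hs ij a Da.
have [t ts _] := normal_sequence_approx ez_normal (covering_matrix_lt Da).
have Ce : C (e s) by apply: hP => //; exists t.
have [Cb _ _] := C_club; apply: trD Da; first exact: Cb.
by have [D_mono _ _] := covD; exact: D_mono ij _ (CD _ Ce).
Qed.

Theorem trace_stabilizes dR (R : orderType dR) dN (N : orderType dN)
    (c : R -> N -> R) (x : set L) :
  uniform_matrix D -> is_regular R -> is_regular N ->
  [set: R] #< [set: L] -> [set: N] #< [set: R] -> [set: T] #< [set: N] ->
  x #< [set: N] -> (forall h, exists w, guesses (c w) h) ->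
  exists b, stable_at (trace x) b.
Proof.
move=> unifD R_reg N_reg RL NR TN xN c_guess.
have NL := card_lt_trans NR RL; have R_card := regular_infinite_cardinal R_reg.
apply: contrapT => /forallNP unstable.
have [e [z [ez_normal z_grow z_anti]]] := anticipating_sequence c L_reg
  (regular_ordinal R_reg) RL NL (@trace_eventually_sub x) unstable.
have z_e s t : s < t -> eventually_sub (trace x (z s)) (trace x (e t)).
  by move=> st; exact/trace_eventually_sub/ltW/(normal_sequence_lt ez_normal).
have [b [i [h hP]]] :=
  uniform_matrix_normal_sequence unifD R_card RL ez_normal.
have [w [c_mono c_closed c_grow]] := c_guess h.
have [n nP] := bigcup_stationary (A := fun n => trace x (e (c w n))) N_reg TN xN
  (fun n j => @subIsetr _ _ _).
have [m1 n_m1] := c_grow n; have [m2 m1_m2] := c_grow m1.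
have [m3 m2_m3] := c_grow m2.
apply: (z_grow (c w m2)); apply: eventually_sub_trans (z_e _ _ m2_m3) _.
apply: (@eventually_sub_trans _ _ _ (initial_union (trace x) e (c w) n)).
  by exists i => j _; exact: nP.
apply: eventually_sub_trans (z_e _ _ m1_m2).
apply: z_anti => [k kn|]; first exact: le_lt_trans (c_mono _ _ kn) n_m1.
exists b, i => j ij a [k _ [Da xa]]; split=> //.
exact: hP (c_closed k) ij _ Da.
Qed.

End Traces.

(** * Coherent families and the covering property *)

Lemma le_PkappaE (K X : Type) (x y : Pkappa K X) :
  (x <= y) = (val x `<=` val y) :> Prop.
Proof. by rewrite -subsetEset. Qed.

Lemma card_lt_Pkappa (K X : Type) (x : Pkappa K X) : val x #< [set: K].
Proof. exact: set_mem (valP x). Qed.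

Lemma cofinal_Pkappa (K X : Type) (G : set (Pkappa K X)) (A : set X) :
  cofinal G -> A #< [set: K] -> exists2 y, G y & A `<=` val y.
Proof.
move=> cofG AK; have [y Gy] := cofG (Sub A (mem_set AK)).
by rewrite le_PkappaE => Ay; exists y.
Qed.

Lemma regular_pigeonhole dW (W : orderType dW) T (f : W -> T) :
  is_regular W -> [set: T] #< [set: W] -> exists t, cofinal (f @^-1` [set t]).
Proof.
move=> W_reg TW; apply: contrapT => /forallNP bounded.
have /choice[u uP] : forall t, exists u, forall a, f a = t -> a < u.
  by move=> t; exact/not_cofinalP/bounded.
have [w uw] := regular_bounded W_reg u TW.
by have := lt_trans (uP _ w erefl) (uw (f w) I); rewrite ltxx.
Qed.

Section CoherentFamilies.
Context (K L : Type) dT (T : orderType dT) (E : Pkappa K L -> T -> set L).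

Definition agree_from (x y : Pkappa K L) (i : T) : Prop :=
  forall j, i <= j -> E x j `&` val x = E y j `&` val x.

Definition coherent : Prop := forall x y, x <= y -> exists i, agree_from x y i.

Lemma agree_from_le x y i k : i <= k -> agree_from x y i -> agree_from x y k.
Proof. by move=> ik xy j kj; apply: xy; exact: le_trans kj. Qed.

Lemma agree_from_trans x y z i : x <= y ->
  agree_from y z i -> (agree_from x y i <-> agree_from x z i).
Proof.
rewrite le_PkappaE => /setIidr xy yz.
have yzx j : i <= j -> E y j `&` val x = E z j `&` val x.
  by move=> /yz yzj; rewrite -xy !setIA yzj.
by split=> xE j ij; rewrite xE // yzx.
Qed.

Lemma agreement_coloring : is_ordinal T -> coherent ->
  exists c : pairs (Pkappa K L) -> T,
    subadditive c /\ forall p, agree_from (val p).1 (val p).2 (c p).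
Proof.
move=> wfT cohE.
have /choice[c cP] : forall p : pairs (Pkappa K L), exists i,
    agree_from (val p).1 (val p).2 i /\
    forall k, agree_from (val p).1 (val p).2 k -> i <= k.
  move=> [[x y] /= xy].
  have [i xyi i_le] := ordinal_least wfT (cohE x y (ltW xy)).
  by exists i.
exists c; split=> [u v w uv vw uw|p]; last by have [] := cP p.
have [[/= auv luv] [/= avw _] [/= auw luw]] :=
  And3 (cP (mkpair uv)) (cP (mkpair vw)) (cP (mkpair uw)).
split; [apply: luw|apply: luv].
  apply/(agree_from_trans (ltW uv)).
    by apply: agree_from_le avw; rewrite le_max lexx orbT.
  by apply: agree_from_le auv; rewrite le_max lexx.
apply/(agree_from_trans (z := w) (ltW uv)).
  by apply: agree_from_le avw; rewrite le_max lexx orbT.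
by apply: agree_from_le auw; rewrite le_max lexx.
Qed.

Lemma uniform_agreement (c : pairs (Pkappa K L) -> T) :
  (forall p, agree_from (val p).1 (val p).2 (c p)) -> ~ strongly_unbounded c ->
  exists2 G, cofinal G &
    exists i, forall x y, G x -> G y -> x <= y -> agree_from x y i.
Proof.
move=> agr_c c_bounded; apply: contrapT => noG.
apply: c_bounded => G cofG; apply: contrapT => /not_cofinalP[i ci].
apply: noG; exists G => //; exists i => x y Gx Gy.
rewrite le_eqVlt => /orP[/eqP->//|xy].
by apply: agree_from_le (agr_c (mkpair xy)); apply/ltW/ci; exists (mkpair xy).
Qed.

End CoherentFamilies.

Theorem coherent_family_covers (K : Type) dT (T : orderType dT)
    dL (L : orderType dL) (E : Pkappa K L -> T -> set L) :
  infinite_set [set: K] -> is_regular L ->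
  is_ordinal T -> [set: T] #< [set: L] ->
  coherent E -> (forall x, {homo E x : i j / i <= j >-> i `<=` j}) ->
  (forall x, val x `<=` \bigcup_i E x i) ->
  ~ (exists c : pairs (Pkappa K L) -> T,
      subadditive c /\ strongly_unbounded c) ->
  exists2 A : set L, cofinal A &
    forall Z, Z `<=` A -> Z #< [set: K] -> exists x i, Z `<=` E x i.
Proof.
move=> Kinf L_reg wfT TL cohE E_mono E_cover /forallNP no_coloring.
have [c [c_sub c_agree]] := agreement_coloring wfT cohE.
have [|G cofG [i iP]] := uniform_agreement c_agree.
  by move=> c_unb; apply: (no_coloring c).
have /choice[X XP] : forall a : L, exists x, G x /\ val x a.
  move=> a; have aK := finite_card_lt (finite_set1 a) Kinf.
  by have [x Gx ax] := cofinal_Pkappa cofG aK; exists x; split=> //; exact: ax.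
have /choice[f fP] : forall a, exists j, i <= j /\ E (X a) j a.
  move=> a; have [j _ Ej] := E_cover _ _ (proj2 (XP a)).
  exists (Order.max i j); split; first by rewrite le_max lexx.
  by apply: E_mono Ej; rewrite le_max lexx orbT.
have [j cofA] := regular_pigeonhole f L_reg TL.
exists (f @^-1` [set j]) => // Z ZA ZK.
have [y Gy Zy] := cofinal_Pkappa cofG ZK.
exists y, j => a Za; have [Gx xa] := XP a; have [+ +] := fP a.
rewrite (ZA a Za) => ij Exa.
have xyK := card_lt_setU Kinf (card_lt_Pkappa (X a)) (card_lt_Pkappa y).
have [z Gz] := cofinal_Pkappa cofG xyK.
rewrite subUset -!le_PkappaE => -[xz yz].
have [Eza _] : (E z j `&` val (X a)) a by rewrite -(iP _ z Gx).
have [] // : (E y j `&` val y) a.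
by rewrite (iP _ z Gy) //; split=> //; exact: Zy.
Qed.

Section StableTraces.
Context (K : Type) dT (T : orderType dT) dL (L : orderType dL).
Context (D : T -> L -> set L).
Hypotheses (L_reg : is_regular L).
Hypotheses (covD : covering_matrix D) (trD : transitive_matrix D).

Lemma stable_at_le (x : set L) (b g : L) :
  b <= g -> stable_at (trace D x) b -> stable_at (trace D x) g.
Proof.
move=> bg b_stable h gh.
apply: eventually_sub_trans (b_stable h (le_trans bg gh)) _.
exact: trace_eventually_sub.
Qed.

Lemma stable_traces_coherent (b : Pkappa K L -> L) :
  (forall x, stable_at (trace D (val x)) (b x)) ->
  coherent (fun x j => D j (b x)).
Proof.
move=> b_stable x y; rewrite le_PkappaE => xy.
apply: eventually_sub_anti; pose g := Order.max (b x) (b y).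
  apply: (@eventually_sub_trans _ _ _ (trace D (val x) g)).
    by apply: trace_eventually_sub => //; rewrite le_max lexx.
  have [|i gy] := b_stable y g; first by rewrite le_max lexx orbT.
  by exists i => j /gy Dgy a [Da xa]; have [] := Dgy a (conj Da (xy a xa)).
apply: (@eventually_sub_trans _ _ _ (trace D (val x) g)).
  by apply: trace_eventually_sub => //; rewrite le_max lexx orbT.
by apply: b_stable; rewrite le_max lexx.
Qed.

Theorem stable_traces_CP : infinite_set [set: K] -> is_ordinal T ->
  [set: T] #< [set: K] -> [set: K] #< [set: L] ->
  ~ (exists c : pairs (Pkappa K L) -> T,
      subadditive c /\ strongly_unbounded c) ->
  (forall x : Pkappa K L, exists b, stable_at (trace D (val x)) b) -> CP D.
Proof.
move=> Kinf wfT TK KL nocol x_stable; have [D_mono D_cup _] := covD.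
have /choice[b bP] : forall x : Pkappa K L, exists b,
    stable_at (trace D (val x)) b /\ forall a, val x a -> a < b.
  move=> x; have [b b_stable] := x_stable x.
  have xL := card_lt_trans (card_lt_Pkappa x) KL.
  have [b' xb'] := regular_bounded L_reg id xL.
  exists (Order.max b b'); split=> [|a xa]; last by rewrite lt_max xb' ?orbT.
  by apply: stable_at_le b_stable; rewrite le_max lexx.
have cohD := stable_traces_coherent (fun x => proj1 (bP x)).
have TL := card_lt_trans TK KL.
have [||A cofA AP] := coherent_family_covers Kinf L_reg wfT TL cohD _ _ nocol.
- by move=> x i j; exact: D_mono.
- by move=> x a xa; rewrite D_cup; exact: (proj2 (bP x)).
exists A => // Z ZA ZT; have [|x [i Zi]] := AP Z ZA; last by exists (b x), i.
by apply: card_le_lt_trans TK; rewrite (card_le_eql ZT) card_lexx.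
Qed.

End StableTraces.

Theorem theorem4p4
    (dK : Order.disp_t) (kappa : orderType dK)
    (dM : Order.disp_t) (mu : orderType dM)
    (dT : Order.disp_t) (cf_mu : orderType dT)
    (dL : Order.disp_t) (mu_plus : orderType dL)
    (kappa_card : is_infinite_cardinal kappa)
    (mu_card : is_infinite_cardinal mu)
    (kappa_lt_mu : [set: kappa] #< [set: mu])
    (cf_muE : is_cofinality cf_mu mu)
    (mu_plusE : is_successor_cardinal mu_plus mu)
    (cf_mu_lt_kappa : [set: cf_mu] #< [set: kappa])
    (no_coloring : ~ exists c : pairs (Pkappa kappa mu_plus) -> cf_mu,
        subadditive c /\ strongly_unbounded c) :
  forall D : cf_mu -> mu_plus -> set mu_plus,
    covering_matrix D -> transitive_matrix D -> uniform_matrix D -> CP D.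
Proof.
move=> D covD trD unifD.
have [[wf_cf _] _ _] := cf_muE; have [_ kappa_inf] := kappa_card.
have [mu_cardinal mu_inf] := mu_card; have [_ mu_lt_plus _] := mu_plusE.
have mu_plus_reg := successor_regular mu_inf mu_plusE.
have mu_singular := cofinality_lt_singular cf_muE
  (card_lt_trans cf_mu_lt_kappa kappa_lt_mu).
have [n [r [n_reg r_reg kappa_n n_r [c c_guesses]]]] :=
  club_guessing_below_singular mu_cardinal mu_singular kappa_inf kappa_lt_mu.
apply: (stable_traces_CP (K := kappa)) => // [|x].
  exact: card_lt_trans kappa_lt_mu mu_lt_plus.
apply: (trace_stabilizes _ _ _ unifD r_reg n_reg _ n_r _ _ c_guesses) => //.
- exact: card_lt_trans (card_lt_segment r mu_cardinal) mu_lt_plus.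
- exact: card_lt_trans cf_mu_lt_kappa kappa_n.
- exact: card_lt_trans (card_lt_Pkappa x) kappa_n.
Qed.
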